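(* Let $\mathcal{H}$ be a Hilbert space, let $\mathcal{K},\mathcal{E}$ be Krein spaces, and let $T\in\mathcal{L}(\mathcal{H},\mathcal{K})$ and $V\in\mathcal{L}(\mathcal{H},\mathcal{E})$ be closed range operators. Assume that $T^\#T$ and $V^\#V$ are indefinite and that $[Ty,Ty]_{\mathcal{K}}\geq0$ for every $y\in\mathcal{H}$ with $[Vy,Vy]_{\mathcal{E}}=0$. Let $Lx=(Tx,Vx)$ for $x\in\mathcal{H}$, and assume that $\rho_-\neq\rho_+$. If $R(L)$ is a pseudo-regular subspace of $(\mathcal{K}\times\mathcal{E},[\cdot,\cdot]_{\rho_0})$ for some $\rho_0\in(\rho_-,\rho_+)$, then it is a pseudo-regular subspace of $(\mathcal{K}\times\mathcal{E},[\cdot,\cdot]_\rho)$ for all $\rho\in(\rho_-,\rho_+)$.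
   Context: $(\mathcal{H},\langle\cdot,\cdot\rangle)$ is a complex separable Hilbert space; $R(\cdot)$ denotes range. The Krein space adjoints are defined by $[Tx,y]_{\mathcal{K}}=\langle x,T^\#y\rangle$ and $[Vx,z]_{\mathcal{E}}=\langle x,V^\#z\rangle$. A bounded selfadjoint operator $C$ on $\mathcal{H}$ is indefinite if $\langle Cx,x\rangle$ takes both strictly positive and strictly negative values. For $\rho\neq0$, $\mathcal{K}\times\mathcal{E}$ is a Krein space with $[(y,z),(y',z')]_\rho=[y,y']_{\mathcal{K}}+\rho\,[z,z']_{\mathcal{E}}$. Define $$\rho_-=-\inf_{\{x\in\mathcal{H}:[Vx,Vx]_{\mathcal{E}}>0\}}\frac{[Tx,Tx]_{\mathcal{K}}}{[Vx,Vx]_{\mathcal{E}}},\qquad \rho_+=-\sup_{\{x\in\mathcal{H}:[Vx,Vx]_{\mathcal{E}}<0\}}\frac{[Tx,Tx]_{\mathcal{K}}}{[Vx,Vx]_{\mathcal{E}}}.$$ Under the stated hypotheses these are real numbers with $\rho_-\leq\rho_+$, the operator $T^\#T+\rho V^\#V$ is positive semidefinite if and only if $\rho\in[\rho_-,\rho_+]$, and $0\notin[\rho_-,\rho_+]$. A subspace $\mathcal{M}$ of a Krein space $(\mathcal{F},[\cdot,\cdot])$ is pseudo-regular if $\mathcal{M}$ is closed and $\mathcal{M}+\mathcal{M}^{[\perp]}$ is closed in $\mathcal{F}$, where $\mathcal{M}^{[\perp]}=\{x\in\mathcal{F}:[x,m]=0\ \forall m\in\mathcal{M}\}$. *)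

(* Defs.v *)
From HB Require Import structures.
From mathcomp Require Import all_boot all_order all_algebra.
From mathcomp Require Export complex.
From mathcomp Require Import mathcomp_extra boolp classical_sets cardinality.
From mathcomp Require Import reals prodnormedzmodule topology normedtype.

Set Implicit Arguments.
Unset Strict Implicit.
Unset Printing Implicit Defensive.

Import numFieldNormedType.Exports.
Import Order.TTheory GRing.Theory Num.Theory.

Local Open Scope classical_set_scope.
Local Open Scope ring_scope.
Local Open Scope complex_scope.

HB.saturate prod.

Section ProdComplete.
Context (R : numFieldType) (U V : completeNormedModType R).

Lemma prod_cauchy_cvg (F : set_system (U * V)%type) :
  ProperFilter F -> cauchy F -> cvg F.
Proof.
move=> FF Fc; apply/cvg_ex.
have c1 : cvg (fst @ F).
  apply: cauchy_cvg => A entA.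
  have /Fc : entourage [set xy : (U * V) * (U * V) | A (xy.1.1, xy.2.1)].
    exists (A, setT); first by split => //=; exact: entourageT.
    by case=> [[x1 x2] [y1 y2]] [/= ? _]; exists ((x1, y1), (x2, y2)).
  by case=> -[P Q] /= [FP FQ] PQA; exists (fst @` P, fst @` Q) => /=;
    [split; [apply: filterS FP => z Pz|apply: filterS FQ => z Qz]; exists z|
     move=> [x y] [/= [p Pp <-] [q Qq <-]]; exact: (PQA (p, q))].
have c2 : cvg (snd @ F).
  apply: cauchy_cvg => A entA.
  have /Fc : entourage [set xy : (U * V) * (U * V) | A (xy.1.2, xy.2.2)].
    exists (setT, A); first by split => //=; exact: entourageT.
    by case=> [[x1 x2] [y1 y2]] [/= _ ?]; exists ((x1, y1), (x2, y2)).
  by case=> -[P Q] /= [FP FQ] PQA; exists (snd @` P, snd @` Q) => /=;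
    [split; [apply: filterS FP => z Pz|apply: filterS FQ => z Qz]; exists z|
     move=> [x y] [/= [p Pp <-] [q Qq <-]]; exact: (PQA (p, q))].
exists (lim (fst @ F), lim (snd @ F)).
move=> A [[P Q] /= [nP nQ] PQA].
have FP : F (fst @^-1` P) by exact: c1.
have FQ : F (snd @^-1` Q) by exact: c2.
by apply: filterS (filterI FP FQ) => -[x y] [/= ? ?]; apply: PQA.
Qed.

HB.instance Definition _ :=
  Uniform_isComplete.Build (U * V)%type prod_cauchy_cvg.

End ProdComplete.

Definition separable (T : topologicalType) :=
  exists2 S : set T, countable S & dense S.

(* The inner products and the indefinite forms below are linear in their first
   argument and take values in R[i], where 0 < z means that z is real and
   positive. *)
Definition hilbert_space (R : realType) (H : completeNormedModType R[i])
    (ip : {dot H for Num.conj}) :=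
  forall x, `|x| ^+ 2 = ip x x.

(* F = Fp [+] Fm where (Fp, B) and (Fm, - B) are Hilbert spaces.  The norm of F
   is only required to be equivalent to the Hilbert norm attached to the
   decomposition: the topology of a Krein space is intrinsic, its norm is not.
   Since F is complete, closedness of Fp and Fm is completeness for B, - B. *)
Definition fundamental_decomposition (R : realType)
    (F : completeNormedModType R[i]) (B : F -> F -> R[i]) (Fp Fm : set F) :=
  [/\ [/\ submod_closed [in Fp], submod_closed [in Fm], closed Fp & closed Fm],
      (forall u, Fp u -> u != 0 -> 0 < B u u) /\
      (forall v, Fm v -> v != 0 -> B v v < 0),
      forall u v, Fp u -> Fm v -> B u v = 0,
      forall x, exists u v, [/\ Fp u, Fm v & x = u + v]
    & exists c d : R[i], [/\ 0 < c, 0 < d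
        & forall u v, Fp u -> Fm v ->
            c * `|u + v| ^+ 2 <= B u u - B v v <= d * `|u + v| ^+ 2]].

Definition krein_space (R : realType) (F : completeNormedModType R[i])
    (B : {hermitian F for false & Num.conj}) :=
  exists Fp Fm : set F, fundamental_decomposition B Fp Fm.

Definition krein_orth (R : realType) (F : completeNormedModType R[i])
    (B : {hermitian F for false & Num.conj}) (M : set F) : set F :=
  [set x | forall m, M m -> B x m = 0].

Definition pseudo_regular (R : realType) (F : completeNormedModType R[i])
    (B : {hermitian F for false & Num.conj}) (M : set F) :=
  [/\ submod_closed [in M], closed M
    & closed [set m + n | m in M & n in krein_orth B M]].

(* The adjoint S is determined by [T x, y] = <x, S y>, and exists by the Riesz
   representation theorem when H is a Hilbert space and T is bounded; the zero
   map is a default value for all other cases. *)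
Definition krein_adjoint (R : realType) (H K : completeNormedModType R[i])
    (ip : {dot H for Num.conj}) (B : {hermitian K for false & Num.conj})
    (T : H -> K) : K -> H :=
  xget (fun=> 0) [set S : K -> H | forall x y, B (T x) y = ip x (S y)].

Definition indefinite (R : realType) (H : completeNormedModType R[i])
    (ip : {dot H for Num.conj}) (C : H -> H) :=
  (exists x, 0 < ip (C x) x) /\ (exists x, ip (C x) x < 0).

Definition prod_form (R : realType) (K E : completeNormedModType R[i])
    (BK : {hermitian K for false & Num.conj})
    (BE : {hermitian E for false & Num.conj}) (rho : R) (p q : K * E) : R[i] :=
  BK p.1 q.1 + rho%:C * BE p.2 q.2.

Section ProdForm.
Context (R : realType) (K E : completeNormedModType R[i]).
Context (BK : {hermitian K for false & Num.conj}).
Context (BE : {hermitian E for false & Num.conj}) (rho : R).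

Lemma prod_form_linearl u' :
  GRing.linear_for *%R (prod_form BK BE rho ^~ u').
Proof.
by move=> a x y; rewrite /prod_form /= !linearPl /= !mulrDr !mulrA addrACA
  (mulrC _ a).
Qed.

Lemma prod_form_linearr u :
  GRing.linear_for (Num.conj \; *%R) (prod_form BK BE rho u).
Proof.
by move=> a x y; rewrite /prod_form /= !linearPr /= !mulrDr !mulrA addrACA
  (mulrC _ (Num.conj a)).
Qed.

HB.instance Definition _ :=
  bilinear_isBilinear.Build R[i] (K * E)%type (K * E)%type R[i]
    *%R (Num.conj \; *%R) (prod_form BK BE rho)
    (prod_form_linearl, prod_form_linearr).

Lemma prod_form_herm x y :
  prod_form BK BE rho x y =
    (-1) ^+ false * Num.conj (prod_form BK BE rho y x).
Proof.
rewrite /prod_form (hermC BK) (hermC BE) !expr0 !mul1r rmorphD rmorphM /=.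
congr (_ + _ * _); apply/esym/conj_Creal.
by rewrite complex_real.
Qed.

HB.instance Definition _ :=
  isHermitianSesquilinear.Build R[i] (K * E)%type false Num.conj
    (prod_form BK BE rho) prod_form_herm.
End ProdForm.

Section ProdKrein.
Context (R : realType).

Lemma fundamental_decompositionZ (F : completeNormedModType R[i])
    (B : {hermitian F for false & Num.conj}) (rho : R) :
  rho != 0 -> krein_space B ->
  exists Fp Fm, fundamental_decomposition (fun x y => rho%:C * B x y) Fp Fm.
Proof.
move=> rho0 [Fp [Fm [[sp sm cp cm] [pp pm] ort dec [c [d [c0 d0 cd]]]]]].
have [r0|r0|/eqP] := ltgtP rho 0; last by rewrite (negPf rho0).
- have rC : 0 < - rho%:C by rewrite -raddfN ltcR oppr_gt0.
  have rC' : rho%:C < 0 by rewrite -oppr_gt0.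
  exists Fm, Fp; split=> //.
  + split=> u Fu u0; first by rewrite nmulr_rgt0 // pm.
    by rewrite nmulr_rlt0 // pp.
  + by move=> u v Fu Fv; rewrite (hermC B) ort // rmorph0 !mulr0.
  + by move=> x; have [u [v [Fu Fv ->]]] := dec x; exists v, u; rewrite addrC.
  + exists (- rho%:C * c), (- rho%:C * d); split; rewrite ?mulr_gt0 //.
    move=> u v Fu Fv; have /andP[h1 h2] := cd v u Fv Fu.
    rewrite -mulrBr -opprB mulrN -mulNr -!mulrA !ler_pM2l // (addrC u).
    by rewrite h1 h2.
- have rC : 0 < rho%:C by rewrite ltcR.
  exists Fp, Fm; split=> //.
  + split=> u Fu u0; first by rewrite pmulr_rgt0 // pp.
    by rewrite pmulr_rlt0 // pm.
  + by move=> u v Fu Fv; rewrite ort // mulr0.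
  + exists (rho%:C * c), (rho%:C * d); split; rewrite ?mulr_gt0 //.
    move=> u v Fu Fv; have /andP[h1 h2] := cd u v Fu Fv.
    by rewrite -mulrBr -!mulrA !ler_pM2l // h1 h2.
Qed.

Lemma submod_closedX (K E : lmodType R[i]) (A : set K) (B : set E) :
  submod_closed [in A] -> submod_closed [in B] ->
  submod_closed [in (A `*` B : set (K * E)%type)].
Proof.
move=> [A0 Ad] [B0 Bd]; split.
  by apply/mem_set; split; apply/set_mem.
move=> a x y /set_mem[/mem_set x1 /mem_set x2] /set_mem[/mem_set y1 /mem_set y2].
by apply/mem_set; split; apply/set_mem; [exact: Ad|exact: Bd].
Qed.

Lemma closedX (K E : completeNormedModType R[i]) (A : set K) (B : set E) :
  closed A -> closed B -> closed (A `*` B : set (K * E)%type).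
Proof.
move=> cA cB.
have -> : A `*` B = (fst @^-1` A) `&` (snd @^-1` B) by [].
by apply: closedI; apply: preimage_closed => // x _; [exact: cvg_fst|exact: cvg_snd].
Qed.

Lemma krein_space_prod (K E : completeNormedModType R[i])
    (BK : {hermitian K for false & Num.conj})
    (BE : {hermitian E for false & Num.conj}) (rho : R) :
  rho != 0 -> krein_space BK -> krein_space BE ->
  krein_space (prod_form BK BE rho).
Proof.
move=> rho0 [Kp [Km [[spK smK cpK cmK] [ppK pmK] oK dK]]].
move=> [c1 [d1 [c10 d10 cd1]]].
move=> /(fundamental_decompositionZ rho0).
move=> [Ep [Em [[spE smE cpE cmE] [ppE pmE] oE dE]]].
move=> [c2 [d2 [c20 d20 cd2]]].
exists (Kp `*` Ep), (Km `*` Em); split.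
- by split; [exact: submod_closedX|exact: submod_closedX|
             exact: closedX|exact: closedX].
- split=> -[x y] [/= Fx Fy] xy0; rewrite /prod_form /=.
  + have [x0|x0] := eqVneq x 0; last first.
      apply: ltr_wpDr; last exact: ppK.
      have [->|/ppE] := eqVneq y 0; first by rewrite linear0r mulr0.
      by move=> /(_ Fy)/ltW.
    rewrite x0 linear0r add0r ppE //.
    by apply: contraNneq xy0 => y0; rewrite x0 y0.
  + have [x0|x0] := eqVneq x 0; last first.
      apply: ltr_wnDr; last exact: pmK.
      have [->|/pmE] := eqVneq y 0; first by rewrite linear0r mulr0.
      by move=> /(_ Fy)/ltW.
    rewrite x0 linear0r add0r pmE //.
    by apply: contraNneq xy0 => y0; rewrite x0 y0.
- move=> [x y] [z t] [/= ? ?] [/= ? ?].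
  by rewrite /prod_form /= oK // oE // addr0.
- move=> [x y]; have [u [v [? ? ->]]] := dK x.
  have [u' [v' [? ? ->]]] := dE y.
  by exists (u, u'), (v, v').
- have s0 : 0 < c1 + c2 by rewrite addr_gt0.
  exists (c1 * c2 / (c1 + c2)), (d1 + d2); split; rewrite ?addr_gt0 //.
    by rewrite divr_gt0 ?mulr_gt0.
  move=> [u u'] [v v'] [/= Fu Fu'] [/= Fv Fv'].
  have /andP[l1 r1] := cd1 u v Fu Fv; have /andP[l2 r2] := cd2 u' v' Fu' Fv'.
  rewrite /prod_form /= opprD addrACA.
  have le_c1 : c1 * c2 / (c1 + c2) <= c1.
    by rewrite ler_pdivrMr // ler_pM2l // lerDr ltW.
  have le_c2 : c1 * c2 / (c1 + c2) <= c2.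
    by rewrite ler_pdivrMr // mulrC ler_pM2l // lerDl ltW.
  have n1 : 0 <= `|u + v| ^+ 2 by rewrite exprn_ge0.
  have n2 : 0 <= `|u' + v'| ^+ 2 by rewrite exprn_ge0.
  rewrite !prod_normE /=; set M := Num.max _ _.
  have [m1 m2] : `|u + v| <= M /\ `|u' + v'| <= M.
    rewrite !comparable_le_max ?lexx ?orbT //;
    by rewrite real_comparable ?normr_real.
  have l4 : M = `|u + v| \/ M = `|u' + v'|.
    by rewrite /M maxEle; case: ifP => _; [right|left].
  have M0 : 0 <= M by apply: le_trans m1.
  have q1 : `|u + v| ^+ 2 <= M ^+ 2 by rewrite lerXn2r ?nnegrE.
  have q2 : `|u' + v'| ^+ 2 <= M ^+ 2 by rewrite lerXn2r ?nnegrE.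
  apply/andP; split; last first.
    rewrite mulrDl; apply: lerD.
      by apply: le_trans r1 _; rewrite ler_pM2l.
    by apply: le_trans r2 _; rewrite ler_pM2l.
  case: l4 => ->.
    apply: le_trans (_ : c1 * `|u + v| ^+ 2 <= _); first by rewrite ler_wpM2r.
    apply: le_trans l1 _; rewrite lerDl.
    by apply: le_trans l2; rewrite mulr_ge0 // ltW.
  apply: le_trans (_ : c2 * `|u' + v'| ^+ 2 <= _); first by rewrite ler_wpM2r.
  apply: le_trans l2 _; rewrite lerDr.
  by apply: le_trans l1; rewrite mulr_ge0 // ltW.
Qed.
End ProdKrein.

Definition pair_map (H K E : Type) (T : H -> K) (V : H -> E) (x : H) : K * E :=
  (T x, V x).

(* B x x is always real, so that Re is only a coercion from R[i] to R; inf and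
   sup are meaningful as soon as the sets are nonempty and bounded. *)
Definition rho_minus (R : realType) (H K E : completeNormedModType R[i])
    (BK : {hermitian K for false & Num.conj})
    (BE : {hermitian E for false & Num.conj}) (T : H -> K) (V : H -> E) : R :=
  - inf [set complex.Re (BK (T x) (T x)) / complex.Re (BE (V x) (V x))
        | x in [set x | 0 < BE (V x) (V x)]].

Definition rho_plus (R : realType) (H K E : completeNormedModType R[i])
    (BK : {hermitian K for false & Num.conj})
    (BE : {hermitian E for false & Num.conj}) (T : H -> K) (V : H -> E) : R :=
  - sup [set complex.Re (BK (T x) (T x)) / complex.Re (BE (V x) (V x))
        | x in [set x | BE (V x) (V x) < 0]].

(* Main.v *)
Require Import Defs.
From HB Require Import structures.
From mathcomp Require Import all_boot all_order all_algebra.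
From mathcomp Require Import mathcomp_extra boolp classical_sets cardinality.
From mathcomp Require Import reals topology normedtype.
From mathcomp Require Import ring.

(** Write B for the form of the Krein space (K x E, [.,.]_rho), M for the range
    of L and M0 for the isotropic part of M, that is M intersected with its
    B-orthogonal companion M'.  The whole dependence on rho is carried by the
    quadratic form B(Lx, Lx) = [Tx, Tx] + rho [Vx, Vx], so it is enough to read
    pseudo-regularity of M off the values B(m, m), m in M, up to equivalence.

    When rho is strictly between rho_- and rho_+, B is positive semidefinite on
    M, and then M + M' is closed if and only if B is coercive on M modulo M0:
    dist(m, M0)^2 <= c B(m, m) for some constant c (coercive_mod_kernel,
    closed_orth_sum_coercive, coercive_closed_orth_sum).  This says that M / M0
    is a Hilbert space for B, and the two implications are the two halves of
    that reading.

    - If B is coercive modulo M0 then Riesz representation holds on M / M0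
      (riesz_mod_kernel).  A point z in the closure of M + M' is orthogonal to
      M0, so B(., z) restricted to M is represented by some m in M; then z - m
      is in M', and z is in M + M'.

    - If G = M + M' is closed, the functionals B(., m) with m in M and
      B(m, m) <= 1 are pointwise bounded on G, because B(m1 + p, m) = B(m1, m)
      for p in M' and Cauchy-Schwarz applies to B on M.  Uniform boundedness
      (weakly_bounded_bounded) turns this into a bound on the norms of these
      functionals, and the norm of B(., m) on G controls the distance from m to
      the B-orthogonal companion of G, which is M0.

    It remains to compare two values of the parameter.  The form for rho is a
    convex combination, with a positive coefficient on rho0, of the forms for
    rho0 and for one of the endpoints rho_-, rho_+; as the latter is positive
    semidefinite, the form for rho dominates a multiple of the form for rho0
    (pencil_dominated).  By symmetry the two forms are equivalent on M, so they
    have the same isotropic part and are coercive together.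

    Positivity at the endpoints amounts to the inequality between the ratios
    [Tx, Tx] / [Vx, Vx] for [Vx, Vx] > 0 and those for [Vx, Vx] < 0
    (pencil_ratio_le).  Since [T., T.] takes negative values, this positivity also
    excludes rho = 0, so that the product space is a Krein space for each rho
    considered. *)

Set Implicit Arguments.
Unset Strict Implicit.
Unset Printing Implicit Defensive.

Import numFieldNormedType.Exports.
Import Order.TTheory GRing.Theory Num.Theory.

Local Open Scope classical_set_scope.
Local Open Scope ring_scope.
Local Open Scope complex_scope.

(** * Hermitian forms on a subspace *)

Section Hermitian.
Context (C : numClosedFieldType) (F : lmodType C).
Implicit Types (a : {hermitian F for false & Num.conj}) (M : set F).

Lemma hermE a x y : a x y = Num.conj (a y x).
Proof. by rewrite (hermC a) expr0 mul1r. Qed.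

Lemma herm_quadD a x y s : a (x + s *: y) (x + s *: y) =
  a x x + (Num.conj s * a x y + s * Num.conj (a x y)) + s * Num.conj s * a y y.
Proof.
rewrite linearDl !linearDr !linearZl_LR !linearZr_LR /= (hermE _ y x).
ring.
Qed.

Section Submodule.
Context (M : set F) (Mmod : submod_closed [in M]).

Lemma submod0 : M 0. Proof. by case: Mmod => /set_mem. Qed.

Lemma submodP s x y : M x -> M y -> M (s *: x + y).
Proof.
by case: Mmod => _ h /mem_set Mx /mem_set My; apply/set_mem; exact: h.
Qed.

Lemma submodZ s x : M x -> M (s *: x).
Proof. by move=> Mx; rewrite -[_ *: _]addr0; apply: submodP => //; exact: submod0. Qed.

Lemma submodD x y : M x -> M y -> M (x + y).
Proof. by move=> Mx My; rewrite -[x]scale1r; exact: submodP. Qed.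

Lemma submodB x y : M x -> M y -> M (x - y).
Proof. by move=> Mx My; rewrite addrC -scaleN1r; exact: submodP. Qed.

(** Positivity is only required on M, since the Krein forms below are indefinite
    on the whole space.  Expanding the form at a(y,y) x - a(x,y) y settles the
    case a(y,y) > 0, hence by symmetry a(x,x) > 0; when both vanish, the value
    at x - a(x,y) y is - 2 |a(x,y)|^2. *)
Lemma cauchy_schwarz_on a : (forall m, M m -> 0 <= a m m) ->
  forall x y, M x -> M y -> `|a x y| ^+ 2 <= a x x * a y y.
Proof.
move=> apos.
have main x y : M x -> M y -> 0 < a y y -> `|a x y| ^+ 2 <= a x x * a y y.
  move=> Mx My y0.
  have cyy : Num.conj (a y y) = a y y by rewrite -hermE.
  have := apos _ (submodD (submodZ (a y y) Mx) (submodZ (- a x y) My)).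
  rewrite herm_quadD !linearZl_LR !linearZr_LR /= !rmorphM !rmorphN /= cyy.
  set t := (X in 0 <= X); have -> : t = a y y * (a x x * a y y - `|a x y| ^+ 2).
    by rewrite normCK /t; ring.
  by rewrite pmulr_rge0 // subr_ge0.
move=> x y Mx My.
have /predU1P[y0|y0] : (a y y == 0) || (0 < a y y) by rewrite eq_sym -le_eqVlt apos.
  have /predU1P[x0|x0] : (a x x == 0) || (0 < a x x) by rewrite eq_sym -le_eqVlt apos.
    have := apos _ (submodD Mx (submodZ (- a x y) My)).
    rewrite herm_quadD x0 y0 mulr0 addr0 add0r normCK rmorphN /=.
    set t := (X in 0 <= X); have -> : t = - ((a x y * Num.conj (a x y)) *+ 2).
      by rewrite /t; ring.
    by rewrite oppr_ge0 mul0r pmulrn_lle0 // -normCK.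
  by rewrite hermE norm_conjC mulrC main.
exact: main.
Qed.

End Submodule.
End Hermitian.

(** * Order and convergence over complex scalars *)

Section ComplexScalars.
Context (R : realType).
Implicit Types x y : R[i].

Lemma ge0_complexE x : 0 <= x -> x = (complex.Re x)%:C.
Proof. by case: x => a b; rewrite lecE /= => /andP[/eqP -> _]. Qed.

Lemma complex_archi x : 0 <= x -> exists n, x < n%:R.
Proof.
move=> x0; have r0 : 0 <= complex.Re x by move: x0; rewrite lecE => /andP[].
exists (Num.truncn (complex.Re x)).+1.
rewrite (ge0_complexE x0) -(rmorph_nat (real_complex R)) ltcR.
exact: truncnS_gt.
Qed.

Lemma half_pow_lt x e : 0 <= x -> 0 < e -> exists n, x * 2^-1 ^+ n < e.
Proof.
move=> x0 e0.
have [n xn] := complex_archi (divr_ge0 x0 (ltW e0)).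
exists n; rewrite exprVn ltr_pdivrMr ?exprn_gt0 // mulrC -ltr_pdivrMr //.
by apply: lt_le_trans xn _; rewrite -natrX ler_nat ltnW // ltn_expl.
Qed.

(** The order of the complex scalars is partial, hence the requirement that both
    sides be real. *)
Lemma le_approx x y : x \is Num.real -> y \is Num.real ->
  (forall e, 0 < e -> x <= y + e) -> x <= y.
Proof.
move=> xr yr xy; rewrite real_leNgt //; apply/negP => yx.
have e0 : 0 < (x - y) / 2 by rewrite divr_gt0 // subr_gt0.
have := xy _ e0; rewrite -subr_ge0.
set t := (X in 0 <= X); have -> : t = - ((x - y) / 2) by rewrite /t; field.
by rewrite oppr_ge0 => /(lt_le_trans e0); rewrite ltxx.
Qed.

(** The lower bound forces every value of f on A to be real, so the infimum can
    be taken over the real parts. *)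
Lemma approximate_minimizer (T : Type) (A : set T) (f : T -> R[i]) D e :
  A !=set0 -> (forall t, A t -> - D <= f t) -> 0 <= D -> 0 < e ->
  exists2 t, A t & forall t', A t' -> f t <= f t' + e.
Proof.
move=> [t0 At0] fD D0 e0.
have Dre := ge0_complexE D0; have ere := ge0_complexE (ltW e0).
have fre t : A t -> f t = (complex.Re (f t))%:C.
  move/fD; rewrite Dre; case: (f t) => u v.
  by rewrite lecE /= oppr0 => /andP[/eqP -> _].
set S := [set complex.Re (f t) | t in A].
have lS : has_inf S.
  split; first by exists (complex.Re (f t0)), t0.
  exists (- complex.Re D) => _ [t At <-].
  by have := fD t At; rewrite Dre (fre _ At) -raddfN lecR.
have er0 : 0 < complex.Re e by move: e0; rewrite ltcE => /andP[].
have [_ [t At <-] tlt] := inf_adherent er0 lS.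
exists t => // t' At'; rewrite (fre _ At) (fre _ At') ere -raddfD lecR ltW //.
apply: lt_le_trans tlt _; rewrite lerD2r.
by apply: (ge_inf lS.2); exists t'.
Qed.

(** For r <= 1/2 the geometric tail is at most twice its first term; this
    explicit rate is what the gliding hump argument uses. *)
Lemma geometric_cvg (F : completeNormedModType R[i]) (u : nat -> F) (D r : R[i]) :
  0 <= D -> 0 < r -> r <= 2^-1 ->
  (forall n, `|u n.+1 - u n| <= D * r ^+ n) ->
  exists l, forall n, `|l - u n| <= 2 * D * r ^+ n.
Proof.
move=> D0 r0 r2 ur.
have rn n : 0 <= r ^+ n by rewrite exprn_ge0 // ltW.
have tail n k : `|u (k + n)%N - u n| <= 2 * D * r ^+ n.
  elim: k n => [|k IHk] n; first by rewrite subrr normr0 !mulr_ge0.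
  rewrite addSnnS -(subrKA (u n.+1)); apply: le_trans (ler_normD _ _) _.
  apply: le_trans (lerD (IHk n.+1) (ur n)) _.
  rewrite -subr_ge0 exprS.
  set t := (X in 0 <= X); have -> : t = D * r ^+ n * (2 * (2^-1 - r)).
    by rewrite /t; field.
  by rewrite !mulr_ge0 // subr_ge0.
have cu : cvg (u @ \oo).
  apply/cauchy_cvgP/cauchy_exP => e e0.
  have [n nlt] : exists n, 2 * D * 2^-1 ^+ n < e by apply: half_pow_lt; rewrite ?mulr_ge0.
  exists (u n); rewrite -ball_normE /=; exists n => //= m /= nm.
  rewrite distrC -(subnK nm); apply: le_lt_trans (tail _ _) _.
  apply: le_lt_trans nlt; rewrite ler_wpM2l ?mulr_ge0 //.
  by rewrite lerXn2r // nnegrE ?invr_ge0 ?ler0n // ltW.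
have /cvgrPdist_lt ul := cu.
exists (lim (u @ \oo)) => n; apply: le_approx => [||e e0].
- exact: normr_real.
- by rewrite ger0_real // !mulr_ge0.
have [N _ /(_ (N + n)%N (leq_addr _ _)) lN] := ul e e0.
rewrite -(subrKA (u (N + n)%N)) addrC; apply: le_trans (ler_normD _ _) _.
exact: lerD (tail _ _) (ltW lN).
Qed.

Lemma closed_approx (F : normedModType R[i]) (M : set F) l : closed M ->
  (forall e, 0 < e -> exists2 m, M m & `|l - m| < e) -> M l.
Proof.
move=> Mc Ml; apply: Mc => U /nbhs_ballP[e /= e0 eU].
have [m Mm lm] := Ml e e0; exists m; split=> //; apply: eU.
by rewrite -ball_normE.
Qed.

End ComplexScalars.

(** * Riesz representation modulo the kernel of a semidefinite form *)

Section Riesz.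
Context (R : realType) (F : completeNormedModType R[i]).
Implicit Types (a b : {hermitian F for false & Num.conj}) (M : set F).

Definition bounded_form a :=
  exists2 K : R[i], 0 <= K & forall x y, `|a x y| <= K * `|x| * `|y|.

(** For a positive semidefinite on M, this is dist(m, M0)^2 <= c a(m, m), where
    M0 = krein_orth a M intersected with M is the kernel of a on M.  A nearby
    k is asked for instead of a distance, so that no infimum is involved. *)
Definition coercive_mod_kernel a M := exists2 c : R[i], 0 <= c &
  forall m, M m -> exists k,
    [/\ M k, krein_orth a M k & `|m - k| ^+ 2 <= c * a m m].

Lemma half_pow_eq0 (x K : R[i]) :
  0 <= K -> (forall n, `|x| <= K * 2^-1 ^+ n) -> x = 0.
Proof.
move=> K0 xK; apply/eqP; rewrite -normr_le0 -[leRHS]add0r.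
apply: le_approx; rewrite ?normr_real ?addr0 // => e e0.
have [n nlt] := half_pow_lt K0 e0; rewrite add0r.
exact: le_trans (xK n) (ltW nlt).
Qed.

Lemma sqr_normB (x y : R[i]) :
  `|x - y| ^+ 2 <= 2 * `|x| ^+ 2 + 2 * `|y| ^+ 2.
Proof.
rewrite -subr_ge0 !normCK.
set t := (X in 0 <= X); have -> : t = `|x + y| ^+ 2.
  by rewrite normCK /t !rmorphB !rmorphD /=; ring.
exact: exprn_ge0.
Qed.

Section OnSubmodule.
Context (a b : {hermitian F for false & Num.conj}) (M : set F) (z : F) (D : R[i]).
Hypotheses (Mmod : submod_closed [in M]) (apos : forall m, M m -> 0 <= a m m).
Hypotheses (bD : forall m, M m -> `|b m z| ^+ 2 <= D * a m m).

(** An approximate minimizer m of q(m) = a(m,m) - 2 Re b(m,z) almost represents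
    b(.,z): moving m along h decreases q by |b(h,z) - a(h,m)|^2 / a(h,h) for the
    best multiple of h, which cannot exceed e. *)
Lemma approx_riesz e : 0 < D -> 0 < e ->
  exists2 m, M m & forall h, M h -> `|b h z - a h m| ^+ 2 <= e * a h h.
Proof.
move=> D0 e0; pose q m := a m m - (b m z + Num.conj (b m z)).
have cD : Num.conj D = D by apply: conj_Creal; rewrite ger0_real // ltW.
have qD m : M m -> - D <= q m.
  (* The square of |b(m,z) - D| and the bound bD give 2 Re b(m,z) <= a(m,m) + D. *)
  move=> Mm; rewrite -subr_ge0 opprK -(pmulr_rge0 _ D0).
  have : 0 <= `|b m z - D| ^+ 2 + (D * a m m - `|b m z| ^+ 2).
    by rewrite addr_ge0 ?exprn_ge0 // subr_ge0 bD.
  set t := (X in 0 <= X -> _); have -> // : t = D * (q m + D).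
  by rewrite /t !normCK rmorphB /= cD /q; ring.
have [m Mm mq] : exists2 m, M m & forall m', M m' -> q m <= q m' + e.
  apply: (@approximate_minimizer R F M q D e) => //; last exact: ltW.
  by exists 0; exact: submod0.
exists m => // h Mh; set x := b h z - a h m; set t := a h h.
have xE : x + a h m = b h z by rewrite subrK.
clearbody x.
have /predU1P[t0|t0] : (t == 0) || (0 < t) by rewrite eq_sym -le_eqVlt apos.
  have := cauchy_schwarz_on Mmod apos Mh Mm; rewrite -/t t0 mul0r.
  rewrite real_exprn_even_le0 ?normr_real // normr_eq0 => /eqP ahm.
  have := bD Mh; rewrite -/t t0 mulr0.
  rewrite real_exprn_even_le0 ?normr_real // normr_eq0 => /eqP bhz.
  by move: xE; rewrite ahm bhz addr0 => ->; rewrite normr0 expr0n mulr0.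
have := mq _ (submodD Mmod Mm (submodZ Mmod (Num.conj x / t) Mh)).
have ct : Num.conj t = t by rewrite -hermE.
rewrite -subr_ge0 => /(mulr_ge0 (ltW t0)).
set y := (X in 0 <= X -> _); have -> : y = e * t - `|x| ^+ 2.
  rewrite /y /q herm_quadD linearDl linearZl_LR !rmorphD !rmorphM !fmorphV /=.
  rewrite ct -/t (hermE a m h) !conjCK normCK -xE rmorphD /=; field.
  by rewrite gt_eqF.
by rewrite subr_ge0.
Qed.

(** The approximate solutions m_n for e = 4^-n form a Cauchy sequence for the
    seminorm of a, as a(h, m_n+1 - m_n) is small compared with a(h,h)^(1/2).
    Coercivity lets each increment be corrected by a kernel element k_n into a
    vector of small norm; the corrections do not change a(h, .), and the
    corrected sequence converges in M by completeness. *)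
Lemma riesz_mod_kernel : closed M -> bounded_form a -> coercive_mod_kernel a M ->
  0 < D -> exists2 m, M m & forall h, M h -> b h z = a h m.
Proof.
move=> Mc [K K0 aK] [c c0 ac] D0; set r : R[i] := 2^-1.
have r0 : 0 < r by rewrite invr_gt0.
have rn n : 0 <= r ^+ n by rewrite exprn_ge0 // ltW.
have /choice[m mP] n : exists x, M x /\
    forall h, M h -> `|b h z - a h x| ^+ 2 <= (r ^+ n) ^+ 2 * a h h.
  by have [x Mx xP] := approx_riesz D0 (exprn_gt0 2 (exprn_gt0 n r0)); exists x.
have Mm n : M (m n) := (mP n).1.
pose d n := m n.+1 - m n.
have Md n : M (d n) by apply: submodB.
have dsmall n : a (d n) (d n) <= (2 * r ^+ n) ^+ 2.
  have [->|dn0] := eqVneq (a (d n) (d n)) 0; first by rewrite exprn_ge0 // mulr_ge0.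
  have dn : 0 < a (d n) (d n) by rewrite lt_def dn0 apos.
  have dE : a (d n) (d n) =
      (b (d n) z - a (d n) (m n)) - (b (d n) z - a (d n) (m n.+1)).
    by rewrite {2}/d linearBr /=; ring.
  rewrite -(ler_pM2r dn) -expr2.
  have := sqr_normB (b (d n) z - a (d n) (m n)) (b (d n) z - a (d n) (m n.+1)).
  rewrite -dE ger0_norm ?apos // => /le_trans; apply.
  have h1 := (mP n).2 _ (Md n); have h2 := (mP n.+1).2 _ (Md n).
  apply: le_trans (lerD (ler_wpM2l _ h1) (ler_wpM2l _ h2)) _ => //.
  rewrite -subr_ge0 (exprS r n); set t := (X in 0 <= X).
  have -> : t = (3 / 2) * ((r ^+ n) ^+ 2 * a (d n) (d n)) by rewrite /t /r; field.
  by rewrite !mulr_ge0 // ltW // divr_gt0.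
have /choice[k kP] n : exists x, [/\ M x, krein_orth a M x
    & `|d n - x| ^+ 2 <= c * a (d n) (d n)] by exact: ac.
pose s n := \sum_(j < n) k j; pose u n := m n - s n.
have sP n : M (s n) /\ forall h, M h -> a h (s n) = 0.
  rewrite /s; elim: n => [|n [IH1 IH2]].
    rewrite big_ord0; split; first exact: submod0.
    by move=> h _; rewrite linear0r.
  have [k1 k2 _] := kP n; rewrite big_ord_recr /=; split; first exact: submodD.
  by move=> h Mh; rewrite linearDr /= IH2 // hermE k2 // conjC0 addr0.
have Mu n : M (u n) by apply: submodB => //; exact: (sP n).1.
have c1 : 0 < c + 1 by rewrite ltr_wpDl.
have [l lu] : exists l, forall n, `|l - u n| <= 2 * (2 * (c + 1)) * r ^+ n.
  apply: geometric_cvg => // [|n]; first by rewrite mulr_ge0 // ltW.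
  have -> : u n.+1 - u n = d n - k n.
    rewrite /u /s big_ord_recr /= -/(s n) /d.
    by rewrite opprB opprD (addrC (- s n)) (addrA (m n.+1)) subrKA addrAC.
  have [_ _ dk] := kP n.
  rewrite -ler_sqr ?nnegrE ?mulr_ge0 //; last exact: ltW.
  apply: le_trans dk _; apply: le_trans (ler_wpM2l c0 (dsmall n)) _.
  rewrite -subr_ge0; set t := (X in 0 <= X).
  have -> : t = (c ^+ 2 + c + 1) * (2 * r ^+ n) ^+ 2 by rewrite /t; ring.
  by rewrite mulr_ge0 ?exprn_ge0 ?addr_ge0 ?mulr_ge0 // exprn_ge0.
have Ml : M l.
  apply: closed_approx => // e e0.
  have [n nlt] : exists n, 2 * (2 * (c + 1)) * 2^-1 ^+ n < e.
    by apply: half_pow_lt; rewrite // !mulr_ge0 // ltW.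
  by exists (u n) => //; apply: le_lt_trans (lu n) nlt.
exists l => // h Mh; apply/eqP; rewrite -subr_eq0; apply/eqP.
apply: (@half_pow_eq0 _ (a h h + 1 + K * `|h| * (2 * (2 * (c + 1))))) => [|n].
  by rewrite !addr_ge0 ?apos // !mulr_ge0 // ltW.
have -> : b h z - a h l = (b h z - a h (m n)) - a h (l - u n).
  by rewrite /u !linearBr /= (sP n).2 // subr0 opprB subrKA.
apply: le_trans (ler_normB _ _) _; rewrite mulrDl; apply: lerD.
  have t0 := apos Mh; have t1 : 0 <= a h h + 1 by rewrite addr_ge0.
  rewrite -ler_sqr ?nnegrE ?mulr_ge0 //.
  apply: le_trans ((mP n).2 _ Mh) _; rewrite exprMn mulrC ler_wpM2r // ?(exprn_ge0 2) //.
  rewrite -subr_ge0; set t := (X in 0 <= X).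
  have -> : t = a h h ^+ 2 + a h h + 1 by rewrite /t; ring.
  by rewrite !addr_ge0 ?exprn_ge0.
apply: le_trans (aK _ _) _; rewrite -!mulrA ler_wpM2l //.
by rewrite ler_wpM2l //; apply: le_trans (lu n) _; rewrite !mulrA.
Qed.

End OnSubmodule.
End Riesz.

(** * Hilbert inner products, uniform boundedness and fundamental symmetries *)

Section Hilbertian.
Context (R : realType) (F : completeNormedModType R[i]).
Implicit Types (a B : {hermitian F for false & Num.conj}).

(** The inner product attached to a fundamental decomposition induces only an
    equivalent norm, hence the two constants. *)
Definition hilbertian a := exists c d : R[i],
  [/\ 0 < c, 0 < d & forall x, c * `|x| ^+ 2 <= a x x <= d * `|x| ^+ 2].

Lemma submod_setT : submod_closed [in [set: F]].
Proof. by split=> [|k x y _ _]; apply/mem_set. Qed.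

Lemma hilbertian_ge0 a : hilbertian a -> forall x, 0 <= a x x.
Proof.
move=> [c [d [c0 _ cd]]] x; have /andP[h _] := cd x.
by apply: le_trans h; rewrite mulr_ge0 ?exprn_ge0 // ltW.
Qed.

Lemma hilbertian_bounded a : hilbertian a -> bounded_form a.
Proof.
move=> ha; have [c [d [c0 d0 cd]]] := ha; exists d; first exact: ltW.
move=> x y; rewrite -ler_sqr ?nnegrE ?mulr_ge0 //; last exact: ltW.
have h := cauchy_schwarz_on submod_setT (a := a) (fun m _ => hilbertian_ge0 ha m)
  (x := x) (y := y) Logic.I Logic.I.
apply: le_trans h _; have /andP[_ hx] := cd x; have /andP[_ hy] := cd y.
apply: le_trans (ler_pM (hilbertian_ge0 ha x) (hilbertian_ge0 ha y) hx hy) _.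
by rewrite !exprMn mulrACA -expr2 mulrA.
Qed.

(** One of x + v and x - v works for v parallel to w: the values of a(., w) at
    these two points differ by 2 a(v, w). *)
Lemma sliding_hump a c (rho : R[i]) x w : 0 < c -> 0 < rho ->
  c * `|w| ^+ 2 <= a w w ->
  exists y, `|y - x| <= rho /\ c * rho * `|w| <= `|a y w|.
Proof.
move=> c0 rho0 caw; have [->|w0] := eqVneq w 0.
  by exists x; rewrite subrr normr0 mulr0 normr_ge0 ltW.
have nw : 0 < `|w| by rewrite normr_gt0.
pose v := (rho / `|w|) *: w.
have nv : `|v| = rho.
  by rewrite normrZ normrM normfV normr_id divfK ?gt_eqF // gtr0_norm.
have av : c * rho * `|w| <= a v w.
  rewrite /v linearZl_LR /= -mulrA mulrAC ler_pdivlMr //.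
  rewrite [leLHS](_ : _ = rho * (c * `|w| ^+ 2)); last by ring.
  by rewrite ler_pM2l.
have lhs0 : 0 <= c * rho * `|w| by rewrite !mulr_ge0 // ltW.
have [big|small] := real_leP (ger0_real lhs0) (normr_real (a (x + v) w)).
  by exists (x + v); rewrite addrC addKr nv.
exists (x - v); rewrite addrC addKr normrN nv lexx; split => //.
rewrite -(lerD2l (`|a (x + v) w|)).
have h : c * rho * `|w| *+ 2 <= `|a (x + v) w| + `|a (x - v) w|.
  apply: le_trans (ler_normB _ _).
  have -> : a (x + v) w - a (x - v) w = a v w *+ 2.
    by rewrite linearDl linearBl /=; ring.
  rewrite normrMn ler_pMn2r //; apply: le_trans (real_ler_norm _) => //.
  exact/ger0_real/(le_trans lhs0 av).
apply: le_trans h; rewrite mulr2n lerD2r; exact: ltW.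
Qed.

(** Uniform boundedness by a gliding hump, without Baire category.  If W is
    unbounded, pick w_n in W with |w_n| > n / r^n and points u_n, each within
    r^n of the previous one, with |a(u_n+1, w_n)| >= c r^n |w_n|.  At the limit l
    the later steps change a(., w_n) by at most half of this hump, so that
    a(l, w_n) is unbounded. *)
Lemma weakly_bounded_bounded a (W : set F) : hilbertian a ->
  (forall x, exists D, forall w, W w -> `|a x w| <= D) ->
  exists2 D : R[i], 0 <= D & forall w, W w -> `|w| <= D.
Proof.
move=> ha weak; apply: contrapT => unbdd.
have [c [d [c0 d0 cd]]] := ha; have [K K0 aK] := hilbertian_bounded ha.
(* The ratio r satisfies 2 K r <= c / 2: the tail after step n moves a(., w_n) by
   at most K * 2 r^(n+1) * |w_n|, half of the hump c r^n |w_n|. *)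
pose r := c / (4 * (c + K)); have cK : 0 < c + K by rewrite ltr_wpDr.
have r0 : 0 < r by rewrite divr_gt0 // mulr_gt0.
have rK : 2 * (K * r) <= c / 2.
  rewrite -subr_ge0 /r; set t := (X in 0 <= X).
  have -> : t = c ^+ 2 / (2 * (c + K)) by rewrite /t; field; rewrite gt_eqF.
  by rewrite divr_ge0 ?exprn_ge0 ?mulr_ge0 // ltW.
have r2 : r <= 2^-1.
  rewrite -subr_ge0 /r; set t := (X in 0 <= X).
  have -> : t = (c + 2 * K) / (4 * (c + K)) by rewrite /t; field; rewrite gt_eqF.
  by rewrite divr_ge0 ?addr_ge0 ?mulr_ge0 ?addr_ge0 // ltW.
have /choice[w wP] n : exists w, W w /\ n%:R < r ^+ n * `|w|.
  apply: contrapT => nw; apply: unbdd; exists (n%:R / r ^+ n).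
    by rewrite divr_ge0 // exprn_ge0 // ltW.
  move=> w Ww; rewrite ler_pdivlMr ?exprn_gt0 // mulrC real_leNgt ?ger0_real //.
    by apply/negP => h; apply: nw; exists w.
  by rewrite mulr_ge0 // exprn_ge0 // ltW.
have /choice[f fP] (p : nat * F) : exists y, `|y - p.2| <= r ^+ p.1 /\
    c * r ^+ p.1 * `|w p.1| <= `|a y (w p.1)|.
  by apply: sliding_hump; rewrite ?exprn_gt0 //; have /andP[] := cd (w p.1).
pose fix u n : F := if n is n'.+1 then f (n', u n') else 0.
have uS n : `|u n.+1 - u n| <= 1 * r ^+ n by rewrite mul1r; exact: (fP (n, u n)).1.
have [l lu] := geometric_cvg ler01 r0 r2 uS.
have [D lD] := weak l.
have D0 : 0 <= D by exact: le_trans (normr_ge0 _) (lD _ (wP 0).1).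
have [n nD] := complex_archi (divr_ge0 D0 (ltW (divr_gt0 c0 (ltr0Sn _ 1)))).
have := le_lt_trans (lD _ (wP n).1); move: nD; rewrite ltr_pdivrMr ?divr_gt0 //.
move=> nD /(_ _ nD); apply/negP; rewrite -real_leNgt ?normr_real //; last first.
  by rewrite ger0_real // mulr_ge0 // divr_ge0 // ltW.
have humps := (fP (n, u n)).2; rewrite /= -/(u n.+1) in humps.
have tail : `|a (u n.+1 - l) (w n)| <= c / 2 * r ^+ n * `|w n|.
  apply: le_trans (aK _ _) _; rewrite ler_wpM2r // distrC.
  apply: le_trans (ler_wpM2l K0 (lu n.+1)) _.
  rewrite mulr1 exprS [leLHS](_ : _ = 2 * (K * r) * r ^+ n); last by ring.
  by rewrite ler_wpM2r // exprn_ge0 // ltW.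
apply: le_trans (_ : c / 2 * (r ^+ n * `|w n|) <= _).
  by rewrite mulrC ler_pM2l ?divr_gt0 // ltW // (wP n).2.
rewrite -(lerD2r (c / 2 * r ^+ n * `|w n|)).
apply: le_trans (_ : `|a (u n.+1) (w n)| <= _).
  by apply: le_trans humps; rewrite -subr_ge0 [X in 0 <= X](_ : _ = 0) //; field.
rewrite -[u n.+1](subrK l) linearDl /= addrC.
by apply: le_trans (ler_normD _ _) _; rewrite lerD2l.
Qed.

(** J is the fundamental symmetry u + v |-> u - v of a fundamental decomposition
    and ip(x, y) = B(J x, y).  The decomposition of a vector is unique because a
    common vector of the two parts would be both positive and negative. *)
Lemma krein_symmetry B : krein_space B ->
  exists (ip : {hermitian F for false & Num.conj}) (J : F -> F),
  [/\ hilbertian ip, forall x y, ip (J x) y = B x y & forall x, J (J x) = x].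
Proof.
move=> [Fp [Fm [[Pm Mm cP cM] [pp pm] ort dec [c [d [c0 d0 cd]]]]]].
have /choice[f fP] x : exists p : F * F, [/\ Fp p.1, Fm p.2 & x = p.1 + p.2].
  by have [u [v [? ? ?]]] := dec x; exists (u, v).
have uniq u v u' v' : Fp u -> Fm v -> Fp u' -> Fm v' ->
    u + v = u' + v' -> u = u' /\ v = v'.
  move=> Fu Fv Fu' Fv' E.
  have D : u - u' = v' - v.
    by apply/eqP; rewrite subr_eq addrAC -subr_eq opprK E addrC.
  have uu : u - u' = 0.
    apply: contrapT => /eqP n0.
    have := pp _ (submodB Pm Fu Fu') n0; rewrite D => /lt_trans.
    move=> /(_ 0); rewrite pm ?ltxx //; last by rewrite -D.
      by move=> /(_ isT).
    exact: submodB.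
  split; first by apply/eqP; rewrite -subr_eq0 uu.
  by apply/esym/eqP; rewrite -subr_eq0 -D uu.
pose J x := (f x).1 - (f x).2.
have JE u v : Fp u -> Fm v -> J (u + v) = u - v.
  move=> Fu Fv; have [F1 F2 E] := fP (u + v).
  by rewrite /J; have [<- <-] := uniq _ _ _ _ Fu Fv F1 F2 E.
have Jlin k x y : J (k *: x + y) = k *: J x + J y.
  have [x1 x2 {1}->] := fP x; have [y1 y2 {1}->] := fP y.
  rewrite scalerDr addrACA JE; [|exact: submodP..].
  by rewrite /J scalerBr opprD addrACA.
have JK x : J (J x) = x.
  have [x1 x2 {2}->] := fP x; rewrite {2}/J JE //; first by rewrite opprK.
  by rewrite -scaleN1r; exact: submodZ.
have JB x y : B (J x) y = B (f x).1 (f y).1 - B (f x).2 (f y).2.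
  have [x1 x2 _] := fP x; have [y1 y2 {1}->] := fP y.
  rewrite /J linearBl !linearDr /= (ort _ _ x1 y2).
  rewrite (hermE B (f x).2 (f y).1) (ort _ _ y1 x2).
  by rewrite conjC0 addr0 add0r.
pose g x y := B (J x) y.
have gl u : GRing.linear_for *%R (g ^~ u).
  by move=> k x y; rewrite /g /= Jlin linearPl.
have gr u : GRing.linear_for (Num.conj \; *%R) (g u).
  by move=> k x y; rewrite /g /= linearPr.
have gh x y : g x y = (-1) ^+ false * Num.conj (g y x).
  by rewrite /g !JB rmorphB /= -!hermE expr0 mul1r.
pose bil := bilinear_isBilinear.Build R[i] F F R[i] *%R (Num.conj \; *%R) g (gl, gr).
pose her := isHermitianSesquilinear.Build R[i] F false Num.conj g gh.
pose ip : {hermitian F for false & Num.conj} := HB.pack g bil her.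
exists ip, J; split=> [|x y|//]; last by rewrite /= /g JK.
exists c, d; split=> // x; rewrite /= /g JB.
by have [x1 x2 xE] := fP x; have := cd _ _ x1 x2; rewrite -xE.
Qed.

End Hilbertian.

(** * Pseudo-regularity as coercivity modulo the isotropic part *)

Section KreinGeometry.
Context (R : realType) (F : completeNormedModType R[i]).
Implicit Types (a B : {hermitian F for false & Num.conj}) (M G : set F).

Lemma symmetry_isometry a B (J : F -> F) :
  (forall x y, a (J x) y = B x y) -> (forall x, J (J x) = x) ->
  forall x y, a (J x) (J y) = a x y.
Proof. by move=> aJ JK x y; rewrite aJ hermE -aJ JK -hermE. Qed.

Lemma krein_bounded B : krein_space B -> bounded_form B.
Proof.
move=> /krein_symmetry[ip [J [hip ipJ JK]]].
have iso := symmetry_isometry ipJ JK.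
have [c [d [c0 d0 cd]]] := hip; exists d; first exact: ltW.
move=> x y; rewrite -ler_sqr ?nnegrE ?mulr_ge0 //; last exact: ltW.
have h := cauchy_schwarz_on (@submod_setT _ F) (a := ip)
  (fun m _ => hilbertian_ge0 hip m) (x := J x) (y := y) Logic.I Logic.I.
rewrite -ipJ; apply: le_trans h _; rewrite iso.
have /andP[_ hx] := cd x; have /andP[_ hy] := cd y.
apply: le_trans (ler_pM (hilbertian_ge0 hip x) (hilbertian_ge0 hip y) hx hy) _.
by rewrite !exprMn mulrACA -expr2 mulrA.
Qed.

Lemma orthogonal_projection a G : hilbertian a ->
  submod_closed [in G] -> closed G ->
  forall x, exists2 y, G y & forall g, G g -> a g x = a g y.
Proof.
move=> ha Gmod Gc x; have a0 := hilbertian_ge0 ha.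
apply: (@riesz_mod_kernel R F a a G x (a x x + 1)) => //.
- move=> m Gm.
  apply: le_trans (cauchy_schwarz_on (@submod_setT _ F) (fun z _ => a0 z)
    Logic.I Logic.I) _.
  by rewrite mulrC ler_wpM2r // lerDl.
- exact: hilbertian_bounded.
- have [c [d [c0 d0 cd]]] := ha; exists c^-1; first by rewrite invr_ge0 ltW.
  move=> m Gm; exists 0; split; first exact: (submod0 Gmod).
    by move=> h _; rewrite linear0l.
  by rewrite subr0 mulrC ler_pdivlMr // mulrC; have /andP[] := cd m.
- by rewrite ltr_wpDl.
Qed.

Lemma submod_orth B M : submod_closed [in krein_orth B M].
Proof.
split=> [|k x y /set_mem Bx /set_mem By]; apply/mem_set => m Mm.
  by rewrite linear0l.
by rewrite linearPl /= Bx // By // mulr0 addr0.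
Qed.

Lemma orth_sum_submod B M : submod_closed [in M] ->
  submod_closed [in [set m + n | m in M & n in krein_orth B M]].
Proof.
move=> Mmod; have Nmod := submod_orth B M; split.
  apply/mem_set; exists 0; first exact: (submod0 Mmod).
  by exists 0; [exact: (submod0 Nmod) | rewrite addr0].
move=> k _ _ /set_mem[x1 Mx1 [x2 Nx2 <-]] /set_mem[y1 My1 [y2 Ny2 <-]].
apply/mem_set; exists (k *: x1 + y1); first exact: submodP.
exists (k *: x2 + y2); first exact: (submodP Nmod).
by rewrite scalerDr addrACA.
Qed.

(** If y is the ip-projection of x on M then J (x - y) is B-orthogonal to M, so
    that x, being B-orthogonal to it, is ip-orthogonal to x - y; hence x = y. *)
Lemma biorthogonal_sub B M : krein_space B ->
  submod_closed [in M] -> closed M -> krein_orth B (krein_orth B M) `<=` M.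
Proof.
move=> /krein_symmetry[ip [J [hip ipJ JK]]] Mmod Mc x xMM.
have iso := symmetry_isometry ipJ JK.
have [y My xy] := orthogonal_projection hip Mmod Mc x.
have orthJ : krein_orth B M (J (x - y)).
  by move=> m Mm; rewrite -ipJ JK hermE linearBr /= xy // subrr conjC0.
have := xMM _ orthJ; rewrite -ipJ iso => x0.
have : ip (x - y) (x - y) = 0.
  by rewrite linearBl /= x0 linearBr /= -xy // subrr subr0.
have [c [d [c0 _ cd]]] := hip; have /andP[+ _] := cd (x - y) => /[swap] ->.
rewrite pmulr_rle0 // real_exprn_even_le0 ?normr_real //= normr_eq0 subr_eq0.
by move=> /eqP ->.
Qed.

(** For m in M let u be the ip-projection of J m on G = M + krein_orth B M, so
    that u represents B(., m) on G.  Then k = m - J u is B-orthogonal to G, hence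
    lies in M by biorthogonality, and |m - k| is comparable to |u|.  The vectors
    u coming from B(m, m) <= 1 are weakly bounded, hence bounded. *)
Lemma closed_orth_sum_coercive B M : krein_space B ->
  submod_closed [in M] -> closed M -> (forall m, M m -> 0 <= B m m) ->
  closed [set m + n | m in M & n in krein_orth B M] -> coercive_mod_kernel B M.
Proof.
move=> hB Mmod Mc Bpos; set G := [set m + n | m in M & n in _] => Gc.
have Gmod : submod_closed [in G] by exact: orth_sum_submod.
have [ip [J [hip ipJ JK]]] := krein_symmetry hB.
have iso := symmetry_isometry ipJ JK.
have ipJr x y : ip x (J y) = B x y by rewrite -[x]JK iso ipJ JK.
(* W consists of the representatives u of B(., m) on G for B(m, m) <= 1.  Pairing
   with x only sees the projection m + p of x on G, and B(m + p, m') = B(m, m'). *)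
pose W := [set u | G u /\ exists2 m, M m & B m m <= 1 /\
  forall g, G g -> B g m = ip g u].
have [D D0 WD] : exists2 D : R[i], 0 <= D & forall u, W u -> `|u| <= D.
  apply: (weakly_bounded_bounded hip) => x.
  have [_ [m Mm [p Np <-]] gE] := orthogonal_projection hip Gmod Gc x.
  exists (B m m + 1) => u [Gu [m' Mm' [m'1 uE]]].
  have -> : ip x u = B m m'.
    rewrite hermE gE // -hermE -uE; last by exists m => //; exists p.
    by rewrite linearDl /= (Np m' Mm') addr0.
  have t0 := Bpos m Mm; rewrite -ler_sqr ?nnegrE ?addr_ge0 //.
  apply: le_trans (cauchy_schwarz_on Mmod Bpos Mm Mm') _.
  apply: le_trans (ler_wpM2l t0 m'1) _; rewrite mulr1 -subr_ge0.
  rewrite [X in 0 <= X](_ : _ = B m m ^+ 2 + B m m + 1); last by ring.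
  by rewrite !addr_ge0 ?exprn_ge0.
have [c [d [c0 d0 cd]]] := hip.
exists (d * D ^+ 2 / c) => [|m Mm]; first by rewrite divr_ge0 ?mulr_ge0 ?exprn_ge0 // ltW.
(* The normalization to B(m, m) = 1 is impossible for isotropic m, which is its
   own k. *)
have [Bm0|Bm0] := eqVneq (B m m) 0.
  exists m; split=> //; last by rewrite subrr normr0 expr0n Bm0 mulr0.
  move=> h Mh; have := cauchy_schwarz_on Mmod Bpos Mm Mh; rewrite Bm0 mul0r.
  by rewrite real_exprn_even_le0 ?normr_real //= normr_eq0 => /eqP.
have t0 : 0 < B m m by rewrite lt_def Bm0 Bpos.
have [u Gu uE] := orthogonal_projection hip Gmod Gc (J m).
have Nk : krein_orth B G (m - J u).
  by move=> g Gg; rewrite linearBl /= -(ipJ (J u)) JK hermE -ipJr uE // -hermE subrr.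
have sub1 : krein_orth B G `<=` krein_orth B M.
  move=> x xG m' Mm'; apply: xG; exists m' => //.
  by exists 0; [exact: (submod0 (submod_orth B M)) | rewrite addr0].
have sub2 : krein_orth B G `<=` M.
  move=> x xG; apply: (biorthogonal_sub hB Mmod Mc) => p Np; apply: xG.
  by exists 0; [exact: (submod0 Mmod) | exists p; rewrite ?add0r].
exists (m - J u); split; [exact: sub2|exact: sub1|].
rewrite subKr mulrAC ler_pdivlMr // mulrC.
have /andP[h1 _] := cd (J u); apply: le_trans h1 _; rewrite iso.
have /andP[_ h2] := cd u; apply: le_trans h2 _; rewrite -mulrA ler_pM2l //.
pose s := (sqrtC (B m m))^-1.
have s0 : 0 < s by rewrite invr_gt0 sqrtC_gt0.
have cs : Num.conj s = s by apply: conj_Creal; rewrite ger0_real // ltW.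
have ss : s * s * B m m = 1 by rewrite -invfM -expr2 sqrtCK mulVf.
clearbody s.
have /WD : W (s *: u).
  split; first exact: submodZ.
  exists (s *: m); first exact: submodZ.
  split; first by rewrite linearZl_LR linearZr_LR /= cs mulrA ss.
  by move=> g Gg; rewrite !linearZr_LR /= -ipJr uE.
rewrite normrZ gtr0_norm // => sD.
have uE2 : `|u| ^+ 2 = (s * `|u|) ^+ 2 * B m m.
  by rewrite -[LHS]mul1r -ss; ring.
by rewrite uE2 ler_pM2r // ler_sqr ?nnegrE ?mulr_ge0 // ltW.
Qed.

(** A limit z of elements of M + krein_orth B M is B-orthogonal to the kernel of
    B on M.  So B(h, z) = B(h - k, z) for every kernel element k, and coercivity
    bounds B(., z) on M by the seminorm of B; its representative m gives the
    decomposition z = m + (z - m). *)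
Lemma coercive_closed_orth_sum B M : krein_space B ->
  submod_closed [in M] -> closed M -> (forall m, M m -> 0 <= B m m) ->
  coercive_mod_kernel B M -> closed [set m + n | m in M & n in krein_orth B M].
Proof.
move=> hB Mmod Mc Bpos Bco z clz; have [K K0 BK] := krein_bounded hB.
have kz k : M k -> krein_orth B M k -> B k z = 0.
  move=> Mk Nk; apply/eqP; rewrite -normr_le0 -[leRHS]add0r.
  have K1 : 0 < K * `|k| + 1 by rewrite ltr_wpDl // mulr_ge0.
  apply: le_approx; rewrite ?normr_real ?addr0 // => e e0; rewrite add0r.
  have [_ [[m Mm [p Np <-]]]] := clz _ (nbhsx_ballx z _ (divr_gt0 e0 K1)).
  have kg : B k (m + p) = 0.
    by rewrite linearDr /= (Nk m Mm) (hermE B k p) (Np k Mk) conjC0 addr0.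
  rewrite -ball_normE /= => zg; rewrite -(subr0 (B k z)) -kg -linearBr.
  apply: le_trans (BK _ _) _; apply: le_trans (ler_wpM2l _ (ltW zg)) _.
    by rewrite mulr_ge0.
  by rewrite mulrA ler_pdivrMr // mulrDr mulr1 mulrC lerDl ltW.
have [c c0 cB] := Bco.
have [m Mm mE] : exists2 m, M m & forall h, M h -> B h z = B h m.
  apply: (@riesz_mod_kernel R F B B M z ((K * `|z|) ^+ 2 * c + 1)) => //.
  - move=> h Mh; have [k [Mk Nk hk]] := cB h Mh.
    have -> : B h z = B (h - k) z by rewrite linearBl /= (kz k Mk Nk) subr0.
    apply: le_trans (_ : ((K * `|z|) * `|h - k|) ^+ 2 <= _).
      by rewrite ler_sqr ?nnegrE ?mulr_ge0 // mulrAC.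
    rewrite exprMn mulrDl mul1r -mulrA; apply: ler_wpDr; first exact: Bpos.
    by rewrite ler_wpM2l // exprn_ge0 // mulr_ge0.
  - by exists K.
  - by rewrite ltr_wpDl // mulr_ge0 // exprn_ge0 // mulr_ge0.
exists m => //; exists (z - m); last by rewrite addrC subrK.
by move=> h Mh; rewrite hermE linearBr /= mE // subrr conjC0.
Qed.

(** Equivalent semidefinite forms have the same isotropic vectors, and by
    Cauchy-Schwarz isotropic vectors are the kernel. *)
Lemma coercive_mod_kernel_equiv a B M s t : submod_closed [in M] ->
  0 < s -> 0 < t -> (forall m, M m -> 0 <= B m m) ->
  (forall m, M m -> s * a m m <= B m m) -> (forall m, M m -> t * B m m <= a m m) ->
  coercive_mod_kernel a M -> coercive_mod_kernel B M.
Proof.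
move=> Mmod s0 t0 Bpos saB tBa [c c0 ca].
exists (c / s) => [|m Mm]; first by rewrite divr_ge0 // ltW.
have [k [Mk Nk mk]] := ca m Mm; exists k; split=> //; last first.
  apply: le_trans mk _; rewrite -mulrA ler_wpM2l //.
  by rewrite mulrC ler_pdivlMr // mulrC saB.
have Bk : B k k = 0.
  by apply: le_anti; rewrite Bpos // -(pmulr_rle0 _ t0) -(Nk k Mk) tBa.
move=> h Mh; have := cauchy_schwarz_on Mmod Bpos Mk Mh; rewrite Bk mul0r.
by rewrite real_exprn_even_le0 ?normr_real //= normr_eq0 => /eqP.
Qed.

End KreinGeometry.

(** * The pencil [Tx, Tx] + rho [Vx, Vx] *)

Section KreinPencil.
Context (R : realType).

Lemma herm_Re (F : lmodType R[i]) (a : {hermitian F for false & Num.conj}) x :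
  a x x = (complex.Re (a x x))%:C.
Proof.
have : a x x \is Num.real by rewrite CrealE -hermE.
rewrite realE => /orP[/ge0_complexE //|]; rewrite -oppr_ge0 => /ge0_complexE.
by rewrite raddfN rmorphN => /oppr_inj.
Qed.

(** Take s of modulus t^(1/2) and of phase i z / |z|, so that the conjugate of s
    times z is purely imaginary. *)
Lemma rotate_cross_term (z t : R[i]) : 0 < t -> exists s : R[i],
  s * Num.conj s = t /\ Num.conj s * z + s * Num.conj z = 0.
Proof.
move=> t0; have ct : Num.conj (sqrtC t) = sqrtC t.
  by apply: conj_Creal; rewrite ger0_real // sqrtC_ge0 ltW.
have tt : sqrtC t * sqrtC t = t by rewrite -expr2 sqrtCK.
have [->|z0] := eqVneq z 0.
  by exists (sqrtC t); rewrite ct tt conjC0 !mulr0 addr0.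
have cn : Num.conj `|z| = `|z| by apply: conj_Creal; exact: normr_real.
have zz := normCK z; have nz : `|z| != 0 by rewrite normr_eq0.
exists (sqrtC t * ('i * z / `|z|)).
rewrite !rmorphM !fmorphV /= ct cn conjCi; split.
  transitivity ((sqrtC t * sqrtC t) * - ('i ^+ 2) * ((z * Num.conj z) / `|z| ^+ 2)).
    by field.
  by rewrite sqrCi opprK mulr1 -zz divff ?mulr1 // expf_eq0.
by field.
Qed.

Section Pencil.
Context (H K E : completeNormedModType R[i]).
Context (BK : {hermitian K for false & Num.conj}).
Context (BE : {hermitian E for false & Num.conj}).
Context (T : {linear H -> K}) (V : {linear H -> E}).
Hypothesis hTV : forall y, BE (V y) (V y) = 0 -> 0 <= BK (T y) (T y).

Local Notation qK x := (complex.Re (BK (T x) (T x))).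
Local Notation qE x := (complex.Re (BE (V x) (V x))).

(** For a scalar s with |s|^2 = - qE x / qE y whose phase kills the cross term,
    both x + s y and x - s y are neutral for [V., V.], so [T., T.] is
    nonnegative at both.  Adding the two values eliminates the cross term of T
    and leaves qK x + |s|^2 qK y >= 0. *)
Lemma pencil_ratio_le x y : 0 < qE x -> qE y < 0 -> qK y / qE y <= qK x / qE x.
Proof.
move=> x0 y0; have t0 : 0 < - (qE x / qE y).
  by rewrite -mulrN -invrN divr_gt0 // oppr_gt0.
have tC : 0 < (- (qE x / qE y))%:C by rewrite ltcR.
have [s [ss sz]] := rotate_cross_term (BE (V x) (V y)) tC.
have neutral e : e * Num.conj e = 1 -> Num.conj e = e ->
    0 <= BK (T (x + (e * s) *: y)) (T (x + (e * s) *: y)).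
  move=> ee ce; apply: hTV; rewrite linearD linearZ /= herm_quadD rmorphM /= ce.
  transitivity (BE (V x) (V x) + e * (Num.conj s * BE (V x) (V y) +
      s * Num.conj (BE (V x) (V y))) + (e * Num.conj e) * (s * Num.conj s) * BE (V y) (V y)).
    by rewrite ce; ring.
  rewrite sz ss ee mulr0 addr0 mul1r (herm_Re BE (V x)) (herm_Re BE (V y)).
  by rewrite -rmorphM -rmorphD /= mulNr divfK ?subrr ?rmorph0 // lt_eqF.
have p1 : 0 <= BK (T (x + (1 * s) *: y)) (T (x + (1 * s) *: y)).
  by apply: neutral; rewrite conjC1 ?mulr1.
have p2 : 0 <= BK (T (x + (-1 * s) *: y)) (T (x + (-1 * s) *: y)).
  by apply: neutral; rewrite rmorphN1 ?mulrNN ?mulr1.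
have TE e : T (x + e *: y) = T x + e *: T y by rewrite linearD linearZ.
have := addr_ge0 p1 p2; rewrite !TE !herm_quadD.
set w := (X in 0 <= X -> _).
have -> : w = 2 * (BK (T x) (T x) + (s * Num.conj s) * BK (T y) (T y)).
  by rewrite /w !rmorphM rmorphN1 rmorph1 /=; ring.
rewrite pmulr_rge0 // ss (herm_Re BK (T x)) (herm_Re BK (T y)).
rewrite -rmorphM -rmorphD lecR /= => h.
rewrite -subr_ge0 -(pmulr_rge0 _ x0).
rewrite [X in 0 <= X](_ : _ = qK x + - (qE x / qE y) * qK y) //.
by field; rewrite lt_eqF // gt_eqF.
Qed.

(** By pencil_ratio_le the sets defining rho_minus and rho_plus are bounded by
    each other's elements, so their infimum and supremum are genuine bounds. *)
Lemma pencil_ge0 rho x :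
  (exists x, 0 < BE (V x) (V x)) -> (exists x, BE (V x) (V x) < 0) ->
  rho_minus BK BE T V <= rho <= rho_plus BK BE T V -> 0 <= qK x + rho * qE x.
Proof.
have ReE0 z : (0 < BE (V z) (V z)) = (0 < qE z).
  by rewrite {1}(herm_Re BE) ltcR.
have ReE1 z : (BE (V z) (V z) < 0) = (qE z < 0).
  by rewrite {1}(herm_Re BE) ltcR.
move=> [u u0] [v v0] /andP[]; rewrite /rho_minus /rho_plus.
set Sp := (X in inf X); set Sm := (X in sup X) => hm hp.
have iSp : has_inf Sp.
  split; first by exists (qK u / qE u), u.
  exists (qK v / qE v) => _ [z z0 <-]; apply: pencil_ratio_le; first by rewrite -ReE0.
  by rewrite -ReE1.
have sSm : has_sup Sm.
  split; first by exists (qK v / qE v), v.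
  exists (qK u / qE u) => _ [z z0 <-]; apply: pencil_ratio_le; first by rewrite -ReE0.
  by rewrite -ReE1.
have [x0|x0|x0] := ltgtP (qE x) 0.
- have : qK x / qE x <= sup Sm.
    by apply: ub_le_sup; [exact: sSm.2 | exists x => //=; rewrite ReE1].
  rewrite lerNr in hp; move=> /le_trans /(_ hp).
  by rewrite ler_ndivrMr // mulNr -subr_ge0 opprK.
- have : inf Sp <= qK x / qE x.
    by apply: ge_inf; [exact: iSp.2 | exists x => //=; rewrite ReE0].
  rewrite lerNl in hm; move=> /(le_trans hm).
  by rewrite ler_pdivlMr // mulNr -subr_ge0 opprK.
- rewrite x0 mulr0 addr0; have : 0 <= BK (T x) (T x).
    by apply: hTV; rewrite (herm_Re BE) x0.
  by rewrite (herm_Re BK) lecR.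
Qed.

Lemma prod_form_diag rho x :
  prod_form BK BE rho (pair_map T V x) (pair_map T V x) = (qK x + rho * qE x)%:C.
Proof.
by rewrite /prod_form /= (herm_Re BK) (herm_Re BE) rmorphD rmorphM.
Qed.

(** rho lies between rho0 and one of the endpoints p, m; s is its barycentric
    coordinate at rho0. *)
Lemma pencil_dominated (p m rho rho0 : R) :
  (forall x, 0 <= qK x + m * qE x) -> (forall x, 0 <= qK x + p * qE x) ->
  m < rho < p -> m < rho0 < p ->
  exists2 s : R, 0 < s &
    forall x, s * (qK x + rho0 * qE x) <= qK x + rho * qE x.
Proof.
move=> qm qp /andP[mr rp] /andP[mr0 r0p].
have [le|lt] := leP rho0 rho.
  have D : 0 < p - rho0 by rewrite subr_gt0.
  exists ((p - rho) / (p - rho0)); first by rewrite divr_gt0 // subr_gt0.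
  move=> x; rewrite -subr_ge0.
  rewrite [X in 0 <= X](_ : _ =
    (rho - rho0) / (p - rho0) * (qK x + p * qE x)); last by field; rewrite gt_eqF.
  by rewrite !mulr_ge0 // ?subr_ge0 // invr_ge0 ltW.
have D : 0 < rho0 - m by rewrite subr_gt0.
exists ((rho - m) / (rho0 - m)); first by rewrite divr_gt0 // subr_gt0.
move=> x; rewrite -subr_ge0.
rewrite [X in 0 <= X](_ : _ =
  (rho0 - rho) / (rho0 - m) * (qK x + m * qE x)); last by field; rewrite gt_eqF.
by rewrite !mulr_ge0 // ?subr_ge0 ?invr_ge0 ltW.
Qed.

End Pencil.

(** The default value 0 of krein_adjoint would make the composite with T vanish
    identically; so an indefinite composite provides the adjoint relation
    without any appeal to Riesz representation in H. *)
Lemma indefinite_adjoint (H K : completeNormedModType R[i])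
    (ip : {dot H for Num.conj}) (B : {hermitian K for false & Num.conj})
    (T : H -> K) : indefinite ip (krein_adjoint ip B T \o T) ->
  (exists x, 0 < B (T x) (T x)) /\ (exists x, B (T x) (T x) < 0).
Proof.
move=> [[x x0] [y y0]].
have [S SP] : exists S, forall x y, B (T x) y = ip x (S y).
  apply: contrapT => nS; move: x0; rewrite /krein_adjoint /= xgetPN ?linear0l ?ltxx //.
  by move=> S SP; apply: nS; exists S.
have adj z w : B (T z) w = ip z (krein_adjoint ip B T w).
  exact: (xgetPex (P := [set S : K -> H | forall x y, B (T x) y = ip x (S y)])
    (fun=> 0) (ex_intro _ S SP)).
have E z : ip ((krein_adjoint ip B T \o T) z) z = B (T z) (T z).
  rewrite (hermE B); apply: etrans (hermE ip _ _) _.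
  by congr Num.conj; rewrite adj.
by split; [exists x | exists y]; rewrite -E.
Qed.

End KreinPencil.

Unset Implicit Arguments.

Theorem proposition4p14 (R : realType)
  (H K E : completeNormedModType R[i])
  (ip : {dot H for Num.conj})
  (formK : {hermitian K for false & Num.conj})
  (formE : {hermitian E for false & Num.conj})
  (T : {linear H -> K}) (V : {linear H -> E})
  (hH : hilbert_space ip) (sepH : separable H)
  (hK : krein_space formK) (hE : krein_space formE)
  (cT : continuous T) (cV : continuous V)
  (rT : closed (range T)) (rV : closed (range V))
  (indT : indefinite ip (krein_adjoint ip formK T \o T))
  (indV : indefinite ip (krein_adjoint ip formE V \o V))
  (hTV : forall y, formE (V y) (V y) = 0 -> 0 <= formK (T y) (T y))
  (hrho : rho_minus formK formE T V <> rho_plus formK formE T V) :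
  (exists rho0 : R,
     rho_minus formK formE T V < rho0 < rho_plus formK formE T V /\
     pseudo_regular (prod_form formK formE rho0) (range (pair_map T V))) ->
  forall rho : R,
    rho_minus formK formE T V < rho < rho_plus formK formE T V ->
    pseudo_regular (prod_form formK formE rho) (range (pair_map T V)).
Proof.
move=> [rho0 [rho0I [Mmod Mc sumc]]] rho rhoI.
have [Vpos Vneg] := indefinite_adjoint indV.
have [_ [y0 Ty0]] := indefinite_adjoint indT.
have psd r x : rho_minus formK formE T V <= r <= rho_plus formK formE T V ->
    0 <= complex.Re (formK (T x) (T x)) + r * complex.Re (formE (V x) (V x)).
  exact: pencil_ge0.
have openW r : rho_minus formK formE T V < r < rho_plus formK formE T V ->
    rho_minus formK formE T V <= r <= rho_plus formK formE T V.
  by move=> /andP[/ltW -> /ltW ->].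
have mp : rho_minus formK formE T V <= rho_plus formK formE T V.
  by have /andP[h1 h2] := rhoI; exact: ltW (lt_trans h1 h2).
(* At r = 0 the form would be [T., T.], which takes a negative value. *)
have nz r : rho_minus formK formE T V < r < rho_plus formK formE T V -> r != 0.
  move=> /openW rI; apply/negP => /eqP r0; rewrite r0 in rI.
  have := psd 0 y0 rI; rewrite mul0r addr0 -lecR -herm_Re.
  by move=> /(lt_le_trans Ty0); rewrite ltxx.
have Mpos r : rho_minus formK formE T V < r < rho_plus formK formE T V ->
    forall m, range (pair_map T V) m -> 0 <= prod_form formK formE r m m.
  by move=> /openW rI _ [x _ <-]; rewrite prod_form_diag lecR; exact: psd.
have dom r s : rho_minus formK formE T V < r < rho_plus formK formE T V ->
    rho_minus formK formE T V < s < rho_plus formK formE T V ->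
    exists2 t : R[i], 0 < t & forall m, range (pair_map T V) m ->
      t * prod_form formK formE s m m <= prod_form formK formE r m m.
  move=> rI sI; have [t t0 tP] := pencil_dominated
    (fun x => psd _ x (introT andP (conj (lexx _) mp)))
    (fun x => psd _ x (introT andP (conj mp (lexx _)))) rI sI.
  exists t%:C; first by rewrite ltcR.
  by move=> _ [x _ <-]; rewrite !prod_form_diag -rmorphM lecR; exact: tP.
split=> //.
have [s s0 sP] := dom _ _ rhoI rho0I; have [t t0 tP] := dom _ _ rho0I rhoI.
apply: coercive_closed_orth_sum => //; [|exact: Mpos|].
  by apply: krein_space_prod => //; exact: nz.
apply: (coercive_mod_kernel_equiv Mmod s0 t0 (Mpos _ rhoI) sP tP).
apply: closed_orth_sum_coercive => //; last exact: Mpos.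
by apply: krein_space_prod => //; exact: nz.
Qed.
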